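(* Let $1\le p<\infty$. For any function $f\in L^1_{\rm loc}(X)$ we have that $f\in L^p(X)$ if and only if $F_f\in L^p(\mathcal{X})$, and in that case $\|F_f\|_{\mathcal{L}^p(\mathcal{X})}=\|f\|_{L^p(X)}$.
   Context: $(X,d_X,\mu)$ is a metric measure space: $(X,d_X)$ is a locally compact separable metric space and $\mu$ is a Borel regular measure with $0<\mu(B(x,r))<\infty$ for every ball. $L^p(X)$, $L^1_{\rm loc}(X)$ are taken with respect to $\mu$. $\mathcal{M}$ is the set of all non-negative finite Borel measures $\nu$ on $X$ with compact support and $\nu\le\mu$; $\|\nu\|=\nu(X)$; $\mathcal{X}=\mathcal{M}\setminus\{0\}$. For $f\in L^1_{\rm loc}(X)$, $F_f:\mathcal{X}\to\mathbb{R}$ is $F_f(\eta)=\frac1{\|\eta\|}\int f\,d\eta$. For $F:\mathcal{X}\to[-\infty,\infty]$, $\|F\|_{\mathcal{L}^p(\mathcal{X})}=\sup\bigl(\sum_{i=1}^k|F(\eta_i)|^p\|\eta_i\|\bigr)^{1/p}$, the supremum being over all finite families $\eta_1,\dots,\eta_k\in\mathcal{X}$ with pairwise disjoint supports. $\mathcal{L}^p(\mathcal{X})$ is the set of $F:\mathcal{X}\to\mathbb{R}$ with $\|F\|_{\mathcal{L}^p(\mathcal{X})}<\infty$. $L^p(\mathcal{X})$ is the set of those $F\in\mathcal{L}^p(\mathcal{X})$ such that the function $G_F:\mathcal{M}\to\mathbb{R}$, $G_F(\eta)=\|\eta\|F(\eta)$ for $\eta\in\mathcal{X}$, $G_F(0)=0$,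 satisfies $G_F(t\eta)=tG_F(\eta)$ for all $t\in[0,1]$, $\eta\in\mathcal{M}$, and $G_F(\sum_{i=1}^\infty\eta_i)=\sum_{i=1}^\infty G_F(\eta_i)$ for all $\eta_i\in\mathcal{M}$ such that $\sum_{i=1}^\infty\eta_i\in\mathcal{M}$. (For $f\in L^1_{\rm loc}(X)$ the function $F_f$ always satisfies these two identities.) *)

(* Defs.v *)
From HB Require Import structures.
From mathcomp Require Import all_boot all_order all_algebra.
From mathcomp Require Import all_classical all_reals all_analysis.

Set Implicit Arguments.
Unset Strict Implicit.
Unset Printing Implicit Defensive.

Import Order.TTheory GRing.Theory Num.Theory.
Import numFieldNormedType.Exports.

Local Open Scope classical_set_scope.
Local Open Scope ring_scope.
Local Open Scope ereal_scope.

(* Measurable types are pointed in the library, metric types are not. *)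
#[short(type="pmetricType")]
HB.structure Definition PMetric (K : numDomainType) :=
  {M of Metric K M & Pointed M}.

(* An outer measure nu as a measure on the sigma-algebra of nu-measurable sets. *)
Definition cara_measure {R : realType} {T : pointedType}
    (nu : {outer_measure set T -> \bar R}) :
  {measure set (caratheodory_type nu) -> \bar R} := nu.

Section MetricMeasureSpace.
Context {R : realType} {X : pmetricType R}.

Local Notation borel := (g_sigma_algebraType (@open X)).
Local Notation bmeasure := {measure set borel -> \bar R}.

(* As usual for metric measure spaces, mu is an outer measure defined on all
   subsets of X. *)
Definition borel_regular (mu : {outer_measure set X -> \bar R}) : Prop :=
  (forall B : set X, <<s @open X >> B -> mu.-caratheodory B) /\
  (forall A : set X, exists2 B : set X, <<s @open X >> B &
    A `<=` B /\ mu B = mu A).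

Definition metric_measure_space (mu : {outer_measure set X -> \bar R}) : Prop :=
  [/\ locally_compact [set: X],
      exists2 D : set X, countable D & dense D,
      borel_regular mu &
      forall (x : X) (r : R), (0 < r)%R -> 0 < mu (ball x r) < +oo].

(* X being locally compact, integrability on compact sets is the same as
   integrability on a neighbourhood of every point. *)
Definition L1loc (mu : {outer_measure set X -> \bar R}) (f : X -> R) : Prop :=
  measurable_fun [set: caratheodory_type mu] (f : caratheodory_type mu -> R) /\
  forall K : set X, compact K -> \int[cara_measure mu]_(x in K) `|f x|%:E < +oo.

Definition msupp (eta : bmeasure) : set X :=
  [set x | forall U : set X, open U -> U x -> 0 < eta U].

Definition calM (mu : {outer_measure set X -> \bar R}) : set bmeasure :=
  [set eta : bmeasure | [/\ eta [set: X] < +oo, compact (msupp eta) &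
    forall A : set borel, measurable A -> eta A <= mu A]].

Definition calX (mu : {outer_measure set X -> \bar R}) : set bmeasure :=
  calM mu `\ (mzero : bmeasure).

Definition mass (eta : bmeasure) : R := fine (eta [set: X]).

(* A mu-measurable f need not be Borel, but it is measurable for the completion
   of any eta in calM mu, hence the integral of f is taken there. *)
Definition completed_integral (eta : bmeasure) (f : X -> R) : R :=
  (\int[@completed_measure_extension _ _ _ eta]_x f x)%R.

Definition Fof (f : X -> R) (eta : bmeasure) : R :=
  ((mass eta)^-1 * completed_integral eta f)%R.

(* Functions on calX mu are represented by functions on all Borel measures; only
   the values on calX mu matter below. *)
Definition calLnorm (mu : {outer_measure set X -> \bar R}) (p : R)
    (F : bmeasure -> \bar R) : \bar R :=
  ereal_sup [set y | exists k (eta : 'I_k -> bmeasure),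
    [/\ forall i, calX mu (eta i),
        trivIset setT (fun i => msupp (eta i)) &
        y = (\sum_(i < k) `|F (eta i)| `^ p * eta i [set: X]) `^ p^-1]].

Definition calL (mu : {outer_measure set X -> \bar R}) (p : R) :
    set (bmeasure -> R) :=
  [set F | calLnorm mu p (EFin \o F) < +oo].

Definition Gof (F : bmeasure -> R) (eta : bmeasure) : R :=
  if `[< eta = mzero >] then 0%R else (mass eta * F eta)%R.

Definition LpX (mu : {outer_measure set X -> \bar R}) (p : R) :
    set (bmeasure -> R) :=
  [set F | [/\ calL mu p F,
    forall (t : {nonneg R}) (eta : bmeasure), (t%:num <= 1)%R -> calM mu eta ->
      Gof F (mscale t eta) = (t%:num * Gof F eta)%R &
    forall eta : bmeasure^nat, (forall i, calM mu (eta i)) ->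
      calM mu (mseries eta 0) ->
      series (fun i => Gof F (eta i)) @ \oo --> Gof F (mseries eta 0)]].

End MetricMeasureSpace.

(* Main.v *)
From HB Require Import structures.
Require Import Defs.
From mathcomp Require Import all_boot all_order all_algebra.
From mathcomp Require Import all_classical all_reals all_analysis.
From mathcomp Require Import measurable_realfun.

Set Implicit Arguments.
Unset Strict Implicit.
Unset Printing Implicit Defensive.

Import Order.TTheory GRing.Theory Num.Theory.
Import numFieldNormedType.Exports.

Local Open Scope classical_set_scope.
Local Open Scope ring_scope.

(** The average [Fof f eta] can only decrease the [p]-th power mean: by Jensen's
    inequality [|Fof f eta|^p * mass eta] is at most the integral of [|f|^p]
    against [eta].  A measure [eta <= mu] is carried by its support, so for
    measures with pairwise disjoint supports these integrals add up to at most
    the integral of [|f|^p] against [mu].  Hence the norm of [Fof f] is at most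
    the norm of [f] ([power_mean_integral], [sum_integral_le], [calLnorm_le]).

    Conversely, the integral of a simple function below [|f|^p] is at most the
    [p]-th power of the norm of [Fof f]: split each level set according to the
    sign of [f] and exhaust every piece from inside by compact sets.  The
    restrictions of [mu] to finitely many disjoint compact sets [K_i] are
    admissible, and if [f] keeps its sign and [|f| >= c_i] on [K_i], then the
    average of [f] over [K_i] is at least [c_i] in absolute value.  Passing to
    the limit in the compact sets and to the supremum over simple functions
    gives the other inequality
    ([abs_average_ge], [compact_approx], [integral_powR_le]).  The two norms
    are thus equal whether finite or not, which yields both the equivalence and
    the equality of norms; scaling and countable additivity of [Gof (Fof f)]
    hold because it is the integral of [f], which is integrable for every measure
    in [calM mu].

    What makes the argument work is topological: a separable metric space has a
    countable basis, so the complement of a support is null; if moreover the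
    space is locally compact it is sigma-compact, and finite Borel measures on
    metric spaces are regular, so Borel sets can be exhausted by compact sets up
    to null sets.

    The function [f] is only measurable for [mu]-measurable sets, and the averages
    are integrals for completed measures.  Borel regularity provides a Borel
    function [g] that agrees with [f] off a Borel null set
    ([borel_representative]), and both sides are rewritten as integrals of [g]
    for Borel measures ([ae_borel_integral], [completed_integralE]). *)

(** * Countable bases and sigma-compactness *)

Local Notation borel X := (g_sigma_algebraType (@open X)).

Section topology.
Context {R : realType} {X : pmetricType R}.

Lemma metric_ball_open (x : X) (r : R) : open (ball x r).
Proof.
rewrite openE => y; rewrite ballEmdist /= => xyr.
apply/nbhs_ballP; exists (r - mdist x y); first by rewrite /= subr_gt0.
move=> z; rewrite !ballEmdist /= => yz.
by rewrite (le_lt_trans (metric_triangle _ y _))// addrC -ltrBrDr.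
Qed.

(** The basis consists of the balls of radius [1/(n+1)] around the points of an
    enumeration of [D]. *)
Lemma separable_countable_basis (D : set X) : countable D -> dense D ->
  exists B : nat -> set X, (forall k, open (B k)) /\
    forall x U, nbhs x U -> exists2 k, B k x & B k `<=` U.
Proof.
move=> cD dD.
have [z [_ Dz]] := dD setT (ex_intro _ point I) openT.
have [D0|/unsquash d] := pfcard_geP cD; first by rewrite D0 in Dz.
pose B k := if unpickle k is Some (i, n) then ball (d i : X) (n.+1%:R^-1 : R)
            else set0.
exists B; split => [k|x U].
  by rewrite /B; case: unpickle => [[i n]|]; [exact: metric_ball_open|exact: open0].
move=> /nbhs_ballP[e /= e0 eU].
have [n] : exists n, n.+1%:R^-1 < e / 2.
  exists (Num.truncn (e / 2)^-1); rewrite -[ltRHS]invrK.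
  rewrite ltf_pV2 ?posrE ?invr_gt0 ?divr_gt0//.
  by rewrite truncnS_gt.
move=> ne.
have n0 : 0 < n.+1%:R^-1 :> R by rewrite invr_gt0.
have [y [xy Dy]] := dD _ (ex_intro _ x (ballxx x n0)) (@metric_ball_open x _).
have [i _ diy] := @surj _ _ _ _ d _ Dy.
exists (pickle (i, n)); rewrite /B pickleK diy; first exact: ball_sym.
move=> w yw; apply: eU.
apply: (@le_ball _ _ _ (n.+1%:R^-1 + n.+1%:R^-1)).
  by rewrite (splitr e) lerD// ltW.
exact: ball_triangle yw.
Qed.

(** The basic open sets with compact closure already cover the space. *)
Lemma locally_compact_sigma_compact (B : nat -> set X) :
  (forall x U, nbhs x U -> exists2 k, B k x & B k `<=` U) ->
  locally_compact [set: X] ->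
  exists K : nat -> set X, (forall n, compact (K n)) /\ \bigcup_n K n = setT.
Proof.
move=> Bb lX.
exists (fun n => if `[< compact (closure (B n)) >] then closure (B n) else set0).
split=> [n|]; first by case: asboolP => // _; exact: compact0.
apply/seteqP; split => // x _.
have [U Ux [cU clU]] := lX x I.
have [|k Bkx BkU] := Bb x U.
  by move: Ux; rewrite /within /= nearE; apply: filterS => y; exact.
exists k => //; rewrite asboolT; first exact: subset_closure.
by rewrite -precompactE; exists U.
Qed.

End topology.

(** * Regularity of Borel measures on metric spaces *)

Local Open Scope ereal_scope.

Section regularity.
Context {R : realType} {X : pmetricType R}.
Variable nu : {measure set (borel X) -> \bar R}.
Hypothesis nu_fin : nu setT < +oo.

Lemma open_borel (U : set X) : open U -> measurable (U : set (borel X)).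
Proof. exact: sub_sigma_algebra. Qed.

Lemma closed_borel (C : set X) : closed C -> measurable (C : set (borel X)).
Proof.
move=> cC; rewrite -[C]setCK; apply: (@measurableC _ (borel X)).
have /open_borel := closed_openC cC; exact.
Qed.

Lemma finite_measure_lty (A : set X) : measurable (A : set (borel X)) -> nu A < +oo.
Proof.
move=> mA; apply: le_lt_trans nu_fin.
by apply: le_measure; [exact: mem_set|exact/mem_set/measurableT|exact: subsetT].
Qed.

Lemma cvg0_lt_eps (u : (\bar R)^nat) (e : R) : (0 < e)%R -> u @ \oo --> 0 ->
  exists n, u n < e%:E.
Proof.
move=> e0 u0.
have : \forall n \near \oo, u n < e%:E.
  apply: (u0 (fun y => y < e%:E)).
  by apply: (open_nbhs_nbhs (conj _ _)); [exact: open_ereal_lt_ereal|rewrite /= lte_fin].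
by move=> [n _ /(_ n (leqnn n))] ?; exists n.
Qed.

(** An open set is the increasing union of the closed sets of points at distance
    at least [1/(n+1)] from its complement. *)
Lemma open_inner_closed (O : set X) (e : R) : open O -> (0 < e)%R ->
  exists C, [/\ closed C, C `<=` O & nu (O `\` C) < e%:E].
Proof.
move=> oO e0.
pose C n := ~` \bigcup_(x in ~` O) (ball x (n.+1%:R^-1 : R)).
have clC n : closed (C n).
  by apply: open_closedC; apply: bigcup_open => x _; exact: metric_ball_open.
have CO n : C n `<=` O.
  move=> x Cx; apply: contrapT => Ox; apply: Cx; exists x => //.
  by apply: ballxx; rewrite invr_gt0.
have : nu \o (fun n => O `\` C n) @ \oo --> nu (\bigcap_n (O `\` C n)).
  have mOC i : measurable (O `\` C i : set (borel X)).
    by apply: measurableD; [exact: open_borel|exact: closed_borel].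
  apply: nonincreasing_cvg_mu => //.
  - exact: finite_measure_lty.
  - exact: bigcapT_measurable.
  - move=> m n mn; apply/subsetPset; apply: setDS; rewrite /C; apply: subsetC.
    apply: subset_bigcup => x _; apply: le_ball.
    by rewrite lef_pV2 ?posrE// ler_nat ltnS.
rewrite (_ : \bigcap_n (O `\` C n) = set0); last first.
  rewrite -subset0 => x OCx.
  have [Ox _] := OCx 0%N I.
  have := open_nbhs_nbhs (conj oO Ox) => /nbhs_ballP[r /= r0 rO].
  have [n] : exists n, (n.+1%:R^-1 < r)%R.
    exists (Num.truncn r^-1); rewrite -[ltRHS]invrK ltf_pV2 ?posrE ?invr_gt0//.
    by rewrite truncnS_gt.
  move=> nr; have [_] := OCx n I; apply => -[y Oy yx]; apply: Oy.
  by apply: rO; apply: le_ball (ltW nr) _ _; exact: ball_sym.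
rewrite measure0 => /(cvg0_lt_eps e0)[n ne].
by exists (C n); split.
Qed.

(** The sets that can be squeezed between a closed and an open set up to small
    measure form a sigma-algebra, which contains the open sets. *)
Lemma finite_borel_regular (A : set X) : measurable (A : set (borel X)) ->
  forall e : R, (0 < e)%R -> exists C U,
    [/\ closed C, open U, C `<=` A, A `<=` U & nu (U `\` C) < e%:E].
Proof.
move=> mA; pose P (A : set X) := forall e : R, (0 < e)%R -> exists C U,
    [/\ closed C, open U, C `<=` A, A `<=` U & nu (U `\` C) < e%:E].
suff : smallest (sigma_algebra setT) (@open X) `<=` P by exact.
apply: smallest_sub; last first.
  move=> O oO e e0; have [C [cC CO Ce]] := open_inner_closed oO e0.
  by exists C, O; split.
split.
- by move=> e e0; exists set0, set0; split => //;
    [exact: closed0|exact: open0|rewrite setD0 measure0 lte_fin].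
- move=> B PB e e0; have [C [U [cC oU CB BU Ue]]] := PB e e0.
  (* Complementation exchanges the inner and the outer approximation. *)
  exists (~` U), (~` C); split.
  + exact: open_closedC.
  + exact: closed_openC.
  + by rewrite setTD; exact: subsetC.
  + by rewrite setTD; exact: subsetC.
  + by rewrite setDE setCK setIC -setDE.
- move=> F PF e e0.
  have e20 : (0 < e / 2)%R by rewrite divr_gt0.
  have /choice[C /choice[U CU]] : forall i, exists C, exists U,
    [/\ closed C, open U, C `<=` F i, F i `<=` U &
       nu (U `\` C) < (e / 2 / (2 ^ i.+1)%:R)%:E].
    by move=> i; apply: PF; rewrite divr_gt0// ltr0n expn_gt0.
  have mC i : measurable (C i : set (borel X)).
    by have [? _ _ _ _] := CU i; exact: closed_borel.
  have mU i : measurable (U i : set (borel X)).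
    by have [_ ? _ _ _] := CU i; exact: open_borel.
  (* An infinite union of closed sets need not be closed: half of [e] pays for
     the errors of the [F i], the other half for truncating the union. *)
  pose U' := \bigcup_i U i; pose C' n := \bigcup_(i < n) C i.
  have mU' : measurable (U' : set (borel X)) by exact: bigcupT_measurable.
  have mC' n : measurable (C' n : set (borel X)) by exact: bigcup_measurable.
  have UC : nu (U' `\` \bigcup_i C i) <= (e / 2)%:E.
    apply: (@le_trans _ _ (\sum_(i <oo) nu (U i `\` C i))).
      apply: measure_sigma_subadditive.
      - by move=> i; exact: measurableD.
      - by apply: measurableD => //; exact: bigcupT_measurable.
      - move=> x [[i _ Uix] nC]; exists i => //; split => // Cx.
        by apply: nC; exists i.
    apply: le_trans (epsilon_trick0 _ (ltW e20)).
    by apply: lee_nneseries => // i _; have [_ _ _ _ /ltW] := CU i.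
  have : nu \o (fun n => U' `\` C' n) @ \oo --> nu (\bigcap_n (U' `\` C' n)).
    apply: nonincreasing_cvg_mu => //.
    - by apply: finite_measure_lty; exact: measurableD.
    - by move=> i; exact: measurableD.
    - by apply: bigcapT_measurable => i; exact: measurableD.
    - move=> m n mn; apply/subsetPset; apply: setDS.
      by move=> x [i /= im Cix]; exists i => //=; exact: leq_trans mn.
  have -> : \bigcap_n (U' `\` C' n) = U' `\` \bigcup_i C i.
    apply/seteqP; split => x.
      move=> H; split; first by have [] := H 0%N I.
      by move=> [i _ Cix]; have [_] := H i.+1 I; apply; exists i => /=.
    by move=> [U'x nC] n _; split => // -[i /= _ Cix]; apply: nC; exists i.
  move=> cv.
  have : \forall n \near \oo, nu (U' `\` C' n) < e%:E.
    apply: (cv (fun y => y < e%:E)).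
    apply: (open_nbhs_nbhs (conj _ _)); first exact: open_ereal_lt_ereal.
    by rewrite /= (le_lt_trans UC)// lte_fin ltr_pdivrMr// ltr_pMr// ltr1n.
  move=> [n _ /(_ n (leqnn n)) ne].
  exists (C' n), U'; split => //.
  + rewrite /C' bigcup_mkord; apply: closed_bigsetU => i _.
    by have [] := CU i.
  + by apply: bigcup_open => i _; have [] := CU i.
  + by move=> x [i _ Cix]; exists i => //; have [_ _ + _ _] := CU i; apply.
  + by move=> x [i _ Fix]; exists i => //; have [_ _ _ + _] := CU i; apply.
Qed.

End regularity.


(** * Transfer of integrals along a measurable map *)

Section transfer.
Context d1 d2 (T1 : measurableType d1) (T2 : measurableType d2) (R : realType).
Variables (phi : T1 -> T2) (m1 : {measure set T1 -> \bar R})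
  (m2 : {measure set T2 -> \bar R}).
Hypothesis mphi : measurable_fun setT phi.
Hypothesis m12 : forall A, measurable A -> m2 A = m1 (phi @^-1` A).

Lemma ge0_integral_image (D : set T2) (f : T2 -> \bar R) : measurable D ->
  measurable_fun D f -> (forall x, D x -> 0 <= f x) ->
  \int[m2]_(x in D) f x = \int[m1]_(x in phi @^-1` D) f (phi x).
Proof.
move=> mD mf f0; rewrite -(ge0_integral_pushforward mphi)//; last first.
  by move=> y; rewrite inE; exact: f0.
by apply: eq_measure_integral => A mA _; exact: m12.
Qed.

Lemma integral_image (f : T2 -> \bar R) : measurable_fun setT f ->
  \int[m2]_x f x = \int[m1]_x f (phi x).
Proof.
move=> mf; rewrite integralE [RHS]integralE.
congr (_ - _).
- rewrite ge0_integral_image ?preimage_setT//; last exact: measurable_funepos.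
  by apply: eq_integral => x _; have := congr1 (@^~ x) (funepos_comp f phi).
- rewrite ge0_integral_image ?preimage_setT//; last exact: measurable_funeneg.
  by apply: eq_integral => x _; have := congr1 (@^~ x) (funeneg_comp f phi).
Qed.

End transfer.

(** * Exhausting Borel sets by compact sets *)

(** The measure need not be finite: regularity is applied to the restrictions of
    [m] to an increasing sequence of relatively compact sets of finite measure
    that covers [X]. *)
Lemma compact_approx (R : realType) (X : pmetricType R)
    (m : {measure set (borel X) -> \bar R}) (L : nat -> set X) :
  (forall n, compact (L n)) -> \bigcup_n L n = setT ->
  (forall (x : X) (r : R), m (ball x r) < +oo) ->
  forall A : set X, measurable (A : set (borel X)) ->
  exists K : nat -> set X, [/\ forall n, compact (K n), forall n, K n `<=` A,
    forall n, m (K n) < +oo & m \o K @ \oo --> m A].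
Proof.
move=> cL LT mball A mA.
have mL n : measurable (L n : set (borel X)).
  by apply: closed_borel; apply: compact_closed => //; exact: metric_hausdorff.
pose V n := \bigcup_(i < n) L i.
pose C n := V n `&` ball (point : X) (n%:R : R).
have mb n : measurable (ball (point : X) (n%:R : R) : set (borel X)).
  by apply: open_borel; exact: metric_ball_open.
have cV n : compact (V n).
  by rewrite /V bigcup_mkord; apply: bigsetU_compact => i _.
have mC n : measurable (C n : set (borel X)).
  apply: (@measurableI _ (borel X)) => //; exact: bigcup_measurable.
have mAC n : measurable (A `&` C n : set (borel X)).
  exact: (@measurableI _ (borel X)).
have Kex n : exists K, [/\ closed K, K `<=` A `&` C n &
    m (A `&` C n) <= m K + (n.+1%:R^-1)%:E].
  pose nu : {measure set (borel X) -> \bar R} := mrestr m (mC n).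
  have nufin : nu setT < +oo.
    rewrite /nu /= /mrestr setTI; apply: le_lt_trans (mball point n%:R).
    by apply: le_measure; [exact: mem_set|exact: mem_set|exact: subIsetr].
  have e0 : (0 < n.+1%:R^-1 :> R)%R by rewrite invr_gt0.
  have [K [U [cK oU KA AU nuUK]]] := finite_borel_regular nufin (mAC n) e0.
  have mK := closed_borel cK; have mU := open_borel oU.
  exists K; split => //.
  have -> : m (A `&` C n) = m K + m ((A `&` C n) `\` K).
    rewrite -measureU //; last 2 first.
    - exact: (@measurableD _ (borel X) _ _ (mAC n) mK).
    - by apply/seteqP; split => // x [Kx []].
    by rewrite setDUK.
  rewrite leeD2l//; apply: le_trans (ltW nuUK); rewrite /nu /= /mrestr.
  apply: le_measure; first apply: mem_set.
    exact: (@measurableD _ (borel X) _ _ (mAC n) mK).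
    apply: mem_set; apply: (@measurableI _ (borel X) _ _ _ (mC n)).
    exact: (@measurableD _ (borel X) _ _ mU mK).
  by move=> x [[Ax Cx] Kx]; split => //; split => //; exact: AU.
have [K Kp] := choice Kex; exists K.
have mK n : measurable (K n : set (borel X)) by have [/closed_borel] := Kp n.
split.
- move=> n; have [cK KAC _] := Kp n.
  by apply: (subclosed_compact cK (cV n)) => x /KAC[_ []].
- by move=> n x; have [_ KAC _] := Kp n; move=> /KAC[].
- move=> n; apply: le_lt_trans (mball point n%:R).
  apply: le_measure; [exact: mem_set|exact: mem_set|].
  by have [_ KAC _] := Kp n; move=> x /KAC[_ []].
- have cvAC : m (A `&` C n) @[n --> \oo] --> m A.
    have E : \bigcup_n (A `&` C n) = A.
      rewrite -setI_bigcupr (_ : \bigcup_n C n = setT) ?setIT//.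
      apply/seteqP; split => // x _.
      have [i _ Lix] : (\bigcup_n L n) x by rewrite LT.
      exists (maxn i (Num.truncn (mdist point x))).+1 => //; split.
        by exists i => //=; rewrite ltnS leq_maxl.
      rewrite ballEmdist /=; apply: (lt_le_trans (truncnS_gt _)).
      by rewrite ler_nat ltnS leq_maxr.
    rewrite -[X in _ --> m X]E.
    apply: (@nondecreasing_cvg_mu _ (borel X) _ m (fun n => A `&` C n)) => //.
      by apply: bigcupT_measurable.
    move=> i j ij; apply/subsetPset; apply: setIS; apply: setISS.
      by move=> x [k /= ki Lk]; exists k => //=; exact: leq_trans ij.
    by apply: le_ball; rewrite ler_nat.
  have cvinv : (n.+1%:R^-1 : R)%:E @[n --> \oo] --> 0.
    by apply/fine_cvgP; split; [exact: nearW|exact: cvg_harmonic].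
  apply: (@squeeze_cvge _ _ _ _ (fun n => m (A `&` C n) - (n.+1%:R^-1)%:E) _ (fun=> m A)).
  + apply: nearW => n; apply/andP; split => /=.
      by rewrite EFinN leeBlDr//; have [] := Kp n.
    apply: le_measure; [exact: mem_set|exact: mem_set|].
    by have [_ KAC _] := Kp n; move=> x /KAC[].
  + rewrite -[m A]sube0; apply: cvgeB => //.
    by rewrite fin_num_adde_defl.
  + exact: cvg_cst.
Qed.


(** * Upper bound for the norm of the averages *)

Section jensen.
Context d (T : measurableType d) (R : realType).
Variables (m : {measure set T -> \bar R}) (p : R) (g : T -> R).
Hypotheses (mT0 : 0 < m setT) (mToo : m setT < +oo) (p1 : (1 <= p)%R)
  (mg : measurable_fun setT g).

Let M := fine (m setT).
Let ME : m setT = M%:E.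
Proof. by rewrite fineK// ge0_fin_numE. Qed.
Let M0 : (0 < M)%R.
Proof. by rewrite /M fine_gt0// mT0. Qed.

(** Jensen's inequality for [t |-> t^p] and the normalised measure, in the form
    of Hoelder's inequality for [g] and the constant function 1. *)
Lemma power_mean_integral :
  `|(M^-1 * fine (\int[m]_x (g x)%:E))%:E| `^ p * m setT <=
  \int[m]_x `|(g x)%:E| `^ p.
Proof.
have p0 : (0 < p)%R by exact: lt_le_trans p1.
set P := (X in _ <= X).
have P0 : 0 <= P by apply: integral_ge0 => x _; exact: poweR_ge0.
have [->|Poo] := eqVneq P +oo; first by rewrite leey.
have PE : P = (fine P)%:E by rewrite fineK// ge0_fin_numE// ltey.
have r0 : (0 <= fine P)%R by exact: fine_ge0.
(* This is the bound of Hoelder's inequality; its exponent of [M] is zero when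
   [p = 1], where the conjugate exponent is infinite. *)
have H : \int[m]_x `|(g x)%:E| <= ((fine P) `^ p^-1 * M `^ (1 - p^-1))%:E.
  move: p1; rewrite le_eqVlt => /predU1P[p1'|p1'].
    rewrite -p1' invr1 subrr powRr0 mulr1 powRr1// -PE /P -p1'.
    by under [leRHS]eq_integral do rewrite poweRe1//.
  have q0 : (0 < 1 - p^-1)%R by rewrite subr_gt0 invf_lt1.
  have mcst : measurable_fun setT (cst 1%R : T -> R) by exact: measurable_cst.
  have q0' : (0 < (1 - p^-1)^-1)%R by rewrite invr_gt0.
  have pq : (p^-1 + (1 - p^-1)^-1^-1 = 1)%R by rewrite invrK addrC subrK.
  have := hoelder m mg mcst p0 q0' pq.
  rewrite (_ : EFin \o cst 1%R = cst 1) // Lnorm_cst1 invrK ME poweR_EFin Lnorm1.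
  rewrite (_ : 'N[m]_p%:E[EFin \o g] = ((fine P) `^ p^-1)%:E); last first.
    by rewrite unlock /= -poweR_EFin -PE.
  by under eq_integral do rewrite /= mulr1.
set A := \int[m]_x `|_| in H.
have A0 : 0 <= A by apply: integral_ge0.
have Afin : A \is a fin_num by rewrite ge0_fin_numE// (le_lt_trans H)// ltry.
have gfin : \int[m]_x (g x)%:E \is a fin_num.
  by rewrite -integral_fin_num_abs// -ge0_fin_numE.
have gA : (`|fine (\int[m]_x (g x)%:E)| <= fine A)%R.
  rewrite -lee_fin fineK// -fine_abse// fineK ?abse_fin_num//.
  by apply: le_abse_integral => //; exact/measurable_EFinP.
have AH : (fine A <= fine P `^ p^-1 * M `^ (1 - p^-1))%R by rewrite -lee_fin fineK.
rewrite ME PE. rewrite abse_EFin poweR_EFin -EFinM lee_fin.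
apply: (@le_trans _ _ ((M^-1 * (fine P `^ p^-1 * M `^ (1 - p^-1))) `^ p * M)%R).
  rewrite ler_pM2r//; apply: ge0_ler_powR.
  - exact: ltW.
  - by rewrite nnegrE.
  - by rewrite nnegrE mulr_ge0 ?invr_ge0 ?mulr_ge0 ?powR_ge0// ltW.
  - rewrite normrM gtr0_norm ?invr_gt0// ler_pM2l ?invr_gt0//.
    exact: le_trans AH.
have -> : (M^-1 * (fine P `^ p^-1 * M `^ (1 - p^-1)) = (fine P / M) `^ p^-1)%R.
  rewrite mulrCA powRM ?invr_ge0 ?(ltW M0)//; congr (_ * _)%R.
  rewrite -(powR_inv1 (ltW M0)) -powRD; last by rewrite (gt_eqF M0) implybT.
  by rewrite addrA addNr add0r -powRrM mulN1r.
by rewrite -powRrM mulVf ?gt_eqF// powRr1 ?divr_ge0 ?(ltW M0)// divfK ?gt_eqF.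
Qed.

End jensen.

Section support.
Context {R : realType} {X : pmetricType R}.
Variables (B : nat -> set X).
Hypothesis oB : forall k, open (B k).
Hypothesis Bb : forall x U, nbhs x U -> exists2 k, B k x & B k `<=` U.
Implicit Types eta m : {measure set (borel X) -> \bar R}.

Lemma msupp_closed eta : closed (msupp eta).
Proof.
rewrite -[msupp eta]setCK; apply: open_closedC.
rewrite openE => x /existsNP[U /not_implyP[oU /not_implyP[Ux Ueta]]].
apply: (filterS _ (open_nbhs_nbhs (conj oU Ux))) => y Uy /(_ U oU Uy).
exact: Ueta.
Qed.

Lemma msupp_borel eta : measurable (msupp eta : set (borel X)).
Proof. by apply: closed_borel; exact: msupp_closed. Qed.

(** The complement of the support is a union of open null sets, which a
    countable basis reduces to a countable union. *)
Lemma measure_setC_msupp eta : eta (~` msupp eta) = 0.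
Proof.
pose N k := if eta (B k) == 0 then B k else set0.
have mN k : measurable (N k : set (borel X)).
  by rewrite /N; case: ifP => // _; exact: open_borel.
have N0 k : eta (N k) = 0 by rewrite /N; case: ifPn => [/eqP|_]; rewrite ?measure0.
apply/eqP; rewrite -measure_le0.
apply: (@le_trans _ _ (\sum_(i <oo) eta (N i))); last first.
  by rewrite eseries0.
apply: measure_sigma_subadditive => //.
  by apply: measurableC; exact: msupp_borel.
move=> x /existsNP[U /not_implyP[oU /not_implyP[Ux Ueta]]].
have [k Bkx BkU] := Bb (open_nbhs_nbhs (conj oU Ux)).
exists k => //; rewrite /N.
rewrite (_ : eta (B k) = 0) ?eqxx//.
have mB := open_borel (oB k); have mU := open_borel oU.
apply: (subset_measure0 mB mU BkU).
by apply/eqP; rewrite -measure_le0 leNgt; exact/negP.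
Qed.

Lemma ge0_integral_msupp eta (f : borel X -> \bar R) : measurable_fun setT f ->
  (forall x, 0 <= f x) -> \int[eta]_x f x = \int[eta]_(x in msupp eta) f x.
Proof.
move=> mf f0.
rewrite (ge0_negligible_integral _ _ _ _ (measure_setC_msupp eta))//.
  by rewrite setTD setCK.
by apply: measurableC; exact: msupp_borel.
Qed.

Lemma ge0_le_integral_msupp m eta (f : borel X -> \bar R) :
  (forall A : set (borel X), measurable A -> eta A <= m A) ->
  measurable_fun setT f -> (forall x, 0 <= f x) ->
  \int[eta]_x f x <= \int[m]_(x in msupp eta) f x.
Proof.
move=> em mf f0; rewrite ge0_integral_msupp//.
by apply: ge0_le_measure_integral => //; exact: msupp_borel.
Qed.

(** Each [eta i] is carried by its support, where it is bounded by [m]. *)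
Lemma sum_integral_le m k (eta : 'I_k -> {measure set (borel X) -> \bar R})
    (f : borel X -> \bar R) :
  (forall i (A : set (borel X)), measurable A -> eta i A <= m A) ->
  trivIset setT (fun i => msupp (eta i)) ->
  measurable_fun setT f -> (forall x, 0 <= f x) ->
  \sum_(i < k) \int[eta i]_x f x <= \int[m]_x f x.
Proof.
move=> em teta mf f0.
apply: (@le_trans _ _ (\sum_(i < k) \int[m]_(x in msupp (eta i)) f x)).
  by apply: lee_sum => i _; exact: (ge0_le_integral_msupp (em i) mf f0).
rewrite -(@ge0_integral_bigsetU _ (borel X) _ m _ (fun i => msupp (eta i)) f
  (index_enum _))//.
- apply: ge0_subset_integral => //.
  by apply: bigsetU_measurable => i _; exact: msupp_borel.
- by move=> i; exact: msupp_borel.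
- exact: index_enum_uniq.
- by apply: sub_trivIset teta.
- by apply: measurable_funTS.
Qed.

End support.


(** * Lower bound for the norm of the averages *)

Section average_bound.
Context d (T : measurableType d) (R : realType).
Variables (eta : {measure set T -> \bar R}) (K : set T).
Hypotheses (eta0 : 0 < eta setT) (etaoo : eta setT < +oo) (mK : measurable K)
  (etaK : eta (~` K) = 0).

Lemma average_ge (g : T -> R) (c : R) : eta.-integrable setT (EFin \o g) ->
  (forall x, K x -> c <= g x)%R ->
  (c <= (fine (eta setT))^-1 * fine (\int[eta]_x (g x)%:E))%R.
Proof.
move=> ig cg.
have eK : eta K = eta setT.
  rewrite -(setUv K) measureU ?setICr//; last exact: measurableC.
  by rewrite [X in _ = (_ + X)%E]etaK adde0.
have etafin : eta setT \is a fin_num by rewrite ge0_fin_numE.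
rewrite mulrC ler_pdivlMr ?fine_gt0 ?eta0// -lee_fin EFinM fineK// fineK; last first.
  exact: integrable_fin_num.
rewrite (negligible_integral _ _ ig etaK)//; last exact: measurableC.
rewrite setTD setCK -eK -integral_cst//.
apply: le_integral => //.
- apply/integrableP; split; first exact: measurable_cst.
  rewrite [X in X < _](_ : _ = \int[eta]_(x in K) (cst `|c|%:E) x)// integral_cst// eK.
  by rewrite lte_mul_pinfty// lee_fin.
- exact: integrableS ig.
- by move=> x; rewrite inE lee_fin; exact: cg.
Qed.

(** If [g] keeps its sign on [K], as [b] records, then averaging produces no
    cancellation. *)
Lemma abs_average_ge (g : T -> R) (c : R) (b : bool) :
  eta.-integrable setT (EFin \o g) ->
  (forall x, K x -> c <= if b then g x else - g x)%R ->
  (c <= `|(fine (eta setT))^-1 * fine (\int[eta]_x (g x)%:E)|)%R.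
Proof.
move=> ig; case: b => cg.
  by apply: le_trans (ler_norm _); exact: average_ge.
rewrite -normrN -mulrN; apply: le_trans (ler_norm _).
have igN : eta.-integrable setT (EFin \o (fun x => - g x)%R).
  rewrite (_ : _ \o _ = \- (EFin \o g)); first exact: integrableN.
  by apply/funext => x /=; rewrite EFinN.
have := average_ge igN cg.
rewrite (_ : fine (\int[eta]_x (- g x)%:E) = - fine (\int[eta]_x (g x)%:E))%R//.
rewrite -fineN; congr fine.
under eq_integral do rewrite EFinN.
rewrite integralN//.
exact: integrable_add_def.
Qed.

End average_bound.

Section lower_bound.
Context {R : realType} {X : pmetricType R}.
Local Notation bmeasure := {measure set (borel X) -> \bar R}.

Definition average (g : borel X -> R) (eta : bmeasure) : R :=
  ((mass eta)^-1 * fine (\int[eta]_x (g x)%:E))%R.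

(** Membership in [calM mu], in terms of the restriction [m] of [mu] to the Borel
    sets. *)
Definition submeasure (m eta : bmeasure) : Prop :=
  [/\ eta setT < +oo, compact (msupp eta) &
    forall A : set (borel X), measurable A -> eta A <= m A].

(* [B] is a countable basis and [L] a cover by compact sets. *)
Variables (m : bmeasure) (B L : nat -> set X) (p : R) (g : borel X -> R).
Hypothesis oB : forall k, open (B k).
Hypothesis Bb : forall x U, nbhs x U -> exists2 k, B k x & B k `<=` U.
Hypothesis cL : forall n, compact (L n).
Hypothesis LT : \bigcup_n L n = setT.
Hypothesis mball : forall (x : X) (r : R), m (ball x r) < +oo.
Hypothesis mg : measurable_fun setT g.
Hypothesis locg : forall K : set X, compact K ->
  \int[m]_(x in K) `|(g x)%:E| < +oo.

Lemma submeasure_integrable (eta : bmeasure) : submeasure m eta ->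
  eta.-integrable setT (EFin \o g).
Proof.
move=> [etaoo ceta etam].
have mabs : measurable_fun setT (fun x => `|(g x)%:E|).
  exact/measurableT_comp/measurable_EFinP.
apply/integrableP; split; first exact/measurable_EFinP.
exact: le_lt_trans (ge0_le_integral_msupp oB Bb etam mabs _) (locg ceta).
Qed.

Section compact_restriction.
Variables (K : set X) (cK : compact K).

Lemma compact_borel : measurable (K : set (borel X)).
Proof. by apply: closed_borel; apply: compact_closed => //; exact: metric_hausdorff. Qed.

Definition compact_restr : bmeasure := mrestr m compact_borel.

Lemma msupp_compact_restr : msupp compact_restr `<=` K.
Proof.
move=> x xs; apply: contrapT => Kx.
have oK : open (~` K).
  by apply: closed_openC; apply: compact_closed => //; exact: metric_hausdorff.
by have := xs _ oK Kx; rewrite /compact_restr /= /mrestr setICl measure0 ltxx.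
Qed.

Lemma compact_restr_setT : compact_restr setT = m K.
Proof. by rewrite /compact_restr /= /mrestr setTI. Qed.

Lemma compact_restr_submeasure : m K < +oo -> submeasure m compact_restr.
Proof.
move=> mK; split; first by rewrite compact_restr_setT.
  apply: (subclosed_compact _ cK); last exact: msupp_compact_restr.
  exact: msupp_closed.
move=> A mA; apply: le_measure; [|exact: mem_set|exact: subIsetl].
by apply: mem_set; apply: measurableI => //; exact: compact_borel.
Qed.

End compact_restriction.

(* [N] stands for the [p]-th power of the norm of the function [average g]. *)
Variable N : \bar R.
Hypothesis p1 : (1 <= p)%R.
Hypothesis HN : forall k (eta : 'I_k -> bmeasure),
  (forall i, submeasure m (eta i)) -> (forall i, 0 < eta i setT) ->
  trivIset setT (fun i => msupp (eta i)) ->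
  \sum_(i < k) `|(average g (eta i))%:E| `^ p * eta i setT <= N.

Let p0 : (0 <= p)%R. Proof. exact: le_trans p1. Qed.

(** The test measures are the restrictions of [m] to the sets [K i]. *)
Lemma sum_compact_le (E : finType) (K : E -> set X) (c : E -> R) (b : E -> bool) :
  (forall i, compact (K i)) -> (forall i, m (K i) < +oo) ->
  trivIset setT K -> (forall i, 0 <= c i)%R ->
  (forall i x, K i x -> c i <= if b i then g x else - g x)%R ->
  \sum_i (c i `^ p)%:E * m (K i) <= N.
Proof.
move=> cK mK tK c0 cg.
(* The null [K i] are left out: the averages are taken over nonzero measures. *)
pose J := [pred i | m (K i) != 0].
have -> : \sum_i (c i `^ p)%:E * m (K i) = \sum_(i in J) (c i `^ p)%:E * m (K i).
  rewrite [RHS]big_mkcond /=; apply: eq_bigr => i _.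
  by rewrite inE; case: eqP => //= ->; rewrite mule0.
rewrite big_enum_val.
pose eta (j : 'I_#|J|) : bmeasure := compact_restr (cK (enum_val j)).
have eta0 j : 0 < eta j setT.
  rewrite /eta compact_restr_setT lt0e measure_ge0 andbT.
  by have := enum_valP j.
apply: le_trans (HN (eta := eta) _ eta0 _).
- apply: lee_sum => j _; rewrite /eta compact_restr_setT.
  rewrite lee_wpmul2r//.
  rewrite abse_EFin poweR_EFin lee_fin; apply: ge0_ler_powR => //; rewrite ?nnegrE//.
  rewrite /average /mass.
  apply: (@abs_average_ge _ _ _ (eta j) (K (enum_val j)) _ _ _ _ _ _ (b (enum_val j))).
  + exact: eta0.
  + by rewrite /eta compact_restr_setT.
  + exact: compact_borel.
  + by rewrite /eta /compact_restr /= /mrestr setICl measure0.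
  + apply: submeasure_integrable; exact: compact_restr_submeasure.
  + exact: cg.
- by move=> j; apply: compact_restr_submeasure.
- apply/trivIsetP => i j _ _ ij; rewrite -subset0 => x [xi xj].
  move/trivIsetP : tK => /(_ (enum_val i) (enum_val j) I I).
  rewrite (inj_eq enum_val_inj) => /(_ ij) <-.
  by split; exact: msupp_compact_restr.
Qed.

(** Compact sets fill up all the [A i] simultaneously. *)
Lemma sum_borel_le (E : finType) (A : E -> set X) (c : E -> R) (b : E -> bool) :
  (forall i, measurable (A i : set (borel X))) ->
  trivIset setT A -> (forall i, 0 <= c i)%R ->
  (forall i x, A i x -> c i <= if b i then g x else - g x)%R ->
  \sum_i (c i `^ p)%:E * m (A i) <= N.
Proof.
move=> mA tA c0 cg.
have /choice[K HK] : forall i, exists K : nat -> set X, [/\ forall n, compact (K n),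
    forall n, K n `<=` A i, forall n, m (K n) < +oo & m \o K @ \oo --> m (A i)].
  by move=> i; exact: compact_approx.
apply: (@cvge_le _ \oo _ _ (fun n => \sum_i (c i `^ p)%:E * m (K i n))).
- apply: nearW => n; apply: (@sum_compact_le _ (K ^~ n) c b) => //.
  + by move=> i; have [] := HK i.
  + by move=> i; have [] := HK i.
  + apply/trivIsetP => i j _ _ ij; move/trivIsetP : tA => /(_ i j I I ij).
    have [_ KAi _ _] := HK i; have [_ KAj _ _] := HK j.
    by rewrite -!subset0; apply: subset_trans; exact: setISS.
  + by move=> i x; have [_ KA _ _] := HK i; move=> /KA; exact: cg.
- apply: cvg_nnesum => i _.
    by apply: nearW => n; rewrite mule_ge0// lee_fin powR_ge0.
  by apply: cvgeZl => //; have [] := HK i.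
Qed.

Import HBNNSimple.

(** The level sets of a simple function below [|g|^p] are cut by the sign of [g],
    so that [sum_borel_le] applies. *)
Lemma integral_powR_le : \int[m]_x `|(g x)%:E| `^ p <= N.
Proof.
rewrite ge0_integralTE; last by move=> x; exact: poweR_ge0.
apply: ge_ereal_sup => _ [h /= hg <-].
rewrite sintegralE fsbig_finite//=.
set s := finmap.enum_fset _; rewrite big_tnth.
pose v (i : 'I_(size s)) : R := tnth (in_tuple s) i.
have v0 i : (0 <= v i)%R.
  have : v i \in s by exact: mem_tnth.
  by rewrite in_fset_set ?inE //; move=> [x _ <-]; exact: fun_ge0.
have pn0 : p != 0%R by rewrite gt_eqF// (lt_le_trans _ p1).
pose c (ib : 'I_(size s) * bool) : R := (v ib.1 `^ p^-1)%R.
pose S (b : bool) : set X := [set x | if b then 0 <= g x else g x < 0]%R.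
pose A (ib : 'I_(size s) * bool) : set X := h @^-1` [set v ib.1] `&` S ib.2.
have mh i : measurable (h @^-1` [set v i] : set (borel X)).
  exact: measurable_sfunP.
have mS b : measurable (S b : set (borel X)).
  rewrite /S; case: b.
  - rewrite -[X in measurable X]setTI.
    by have := mg measurableT (measurable_itv `[0%R, +oo[); rewrite preimage_itvcy.
  - rewrite -[X in measurable X]setTI.
    by have := mg measurableT (measurable_itv `]-oo, 0%R[); rewrite preimage_itvNyo.
have mA ib : measurable (A ib : set (borel X)) by exact: measurableI.
apply: (@le_trans _ _ (\sum_ib (c ib `^ p)%:E * m (A ib))); last first.
  apply: (@sum_borel_le _ A c snd) => //.
  - apply/trivIsetP => -[i b] [j b'] _ _ ij; rewrite -subset0 => x.
    rewrite /A /S /= => -[[hi gi] [hj gj]]; move: ij.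
    have -> : i = j.
      have : v i = v j by rewrite -hi.
      rewrite /v !(tnth_nth 0%R) /= => /eqP; rewrite nth_uniq// => [/eqP|].
        exact: val_inj.
      exact: finmap.fset_uniq.
    case: b b' gi gj => [] [] //=; rewrite ?eqxx//.
      by move=> /le_lt_trans H /H; rewrite ltxx.
    by move=> H /le_lt_trans /(_ H); rewrite ltxx.
  - by move=> ib; exact: powR_ge0.
  - move=> [i b] x [/= hx gx]; have := hg x.
    rewrite hx lee_fin => vg.
    have -> : (if b then g x else - g x)%R = `|g x|%R.
      by case: b gx => /= gx; [rewrite ger0_norm|rewrite ltr0_norm].
    rewrite /c /= -[leRHS]powRr1// -(divff pn0) powRrM.
    by apply: ge0_ler_powR; rewrite ?nnegrE ?powR_ge0// invr_ge0.
rewrite -(pair_bigA _ (fun i b => (c (i, b) `^ p)%:E * m (A (i, b)))) /=.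
apply: lee_sum => i _; rewrite big_bool /=.
rewrite /c /= -powRrM mulVf// powRr1// -ge0_muleDr//.
rewrite lee_wpmul2l ?lee_fin// -measureU//; last first.
  rewrite -subset0 /A /S => x /= [[_ +] [_ gx]].
  by move=> /le_lt_trans /(_ gx); rewrite ltxx.
apply: le_measure; [exact: mem_set|apply: mem_set; exact: measurableU|].
move=> x hx; rewrite /A /S; have [gx|gx] := leP 0%R (g x).
  by left; split.
by right; split.
Qed.

End lower_bound.


(** * Borel representatives and completed measures *)

Section transfer_null_set.
Context {R : realType} {X : pmetricType R}.
Variables (nu : {outer_measure set X -> \bar R})
  (m : {measure set (borel X) -> \bar R}).
Hypothesis nuB : forall A : set X, measurable (A : set (borel X)) ->
  nu.-caratheodory A.
Hypothesis mnu : forall A : set X, measurable (A : set (borel X)) -> m A = nu A.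
Variables (N : set X).
Hypotheses (mN : measurable (N : set (borel X))) (N0 : m N = 0).

Variables (u : X -> \bar R) (v : borel X -> \bar R).
Hypotheses (mv : measurable_fun setT v) (uv : forall x, ~ N x -> u x = v x).

Let mid : measurable_fun setT (idfun : caratheodory_type nu -> borel X).
Proof. by move=> _ A mA; rewrite setTI; exact: nuB. Qed.

Let mvc : measurable_fun setT (v : caratheodory_type nu -> \bar R).
Proof. exact: (measurableT_comp mv mid). Qed.

Let vu : ae_eq (cara_measure nu) setT (v : caratheodory_type nu -> \bar R) u.
Proof.
exists N; split; [exact: nuB|by rewrite -[LHS](mnu mN)|].
by move=> x /= /not_implyP[_ vux]; apply: contrapT => /uv /esym.
Qed.

(** The measure on the Caratheodory sigma-algebra is complete, so that a change
    on a null set preserves measurability. *)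
Lemma ae_borel_measurable :
  measurable_fun setT (u : caratheodory_type nu -> \bar R).
Proof.
exact: (ae_measurable_fun (@measure_is_complete_caratheodory _ _ nu) vu mvc).
Qed.

Lemma ae_borel_integral :
  \int[cara_measure nu]_x u x = \int[m]_x v x.
Proof.
rewrite (@integral_image _ _ (caratheodory_type nu) (borel X) _
  (idfun : caratheodory_type nu -> borel X) (cara_measure nu) m mid mnu _ mv).
apply: ae_eq_integral => //; first exact: ae_borel_measurable.
exact: ae_eq_sym.
Qed.

End transfer_null_set.

Section borel_representative.
Context {R : realType} {X : pmetricType R}.
Variable mu : {outer_measure set X -> \bar R}.
Hypothesis muR : borel_regular mu.
Hypothesis muball : forall (x : X) (r : R), (0 < r)%R -> mu (ball x r) < +oo.

(** On sets of finite measure, a Borel hull of the same measure differs from a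
    measurable set by a null set, which in turn has a null Borel hull.  The balls
    around a fixed point reduce the general case to this one. *)
Lemma cara_borel_approx (A : set X) : mu.-caratheodory A ->
  exists S N : set X, [/\ measurable (S : set (borel X)),
    measurable (N : set (borel X)), mu N = 0 &
    forall x, ~ N x -> (A x <-> S x)].
Proof.
move=> cA; have [Bc Br] := muR.
pose b n := ball (point : X) (n.+1%:R : R).
have bB n : mu.-caratheodory (b n).
  by apply: Bc; apply: open_borel; exact: metric_ball_open.
have /choice[SN HSN] : forall n, exists SN : set X * set X,
    [/\ measurable (SN.1 : set (borel X)), measurable (SN.2 : set (borel X)),
      mu SN.2 = 0, A `&` b n `<=` SN.1 & SN.1 `\` (A `&` b n) `<=` SN.2].
  move=> n.
  have [S mS [AS muS]] := Br (A `&` b n).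
  have [N mN [SN muN]] := Br (S `\` (A `&` b n)).
  exists (S, N); split => //=.
  rewrite muN setDE.
  have cAb := caratheodory_measurable_setI cA (bB n).
  have fin : mu (A `&` b n) \is a fin_num.
    rewrite ge0_fin_numE ?outer_measure_ge0//.
    apply: le_lt_trans (muball point (r := n.+1%:R) _); last by [].
    by apply: le_outer_measure; exact: subIsetr.
  have := cAb S; rewrite muS (setIidr AS) => E.
  by rewrite -[LHS](addeK (x := mu (A `&` b n)))// [X in X - _]addeC -E subee.
exists (\bigcup_n (SN n).1), (\bigcup_n (SN n).2); split.
- by apply: bigcupT_measurable => n; have [] := HSN n.
- by apply: bigcupT_measurable => n; have [] := HSN n.
- apply/eqP; rewrite eq_le outer_measure_ge0 andbT.
  apply: le_trans (outer_measure_sigma_subadditive _ _) _.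
  by rewrite eseries0// => n _ _; have [] := HSN n.
- move=> x Nx; split.
  + move=> Ax; exists (Num.truncn (mdist point x)) => //.
    have [_ _ _ + _] := HSN (Num.truncn (mdist point x)).
    apply; split => //; rewrite /b ballEmdist /=.
    exact: truncnS_gt.
  + move=> [n _ Sx]; have [_ _ _ _ H] := HSN n.
    apply: contrapT => Ax; apply: Nx; exists n => //; apply: H; split => //.
    by case.
Qed.

(** The sublevel sets [f < q] for rational [q] are countably many, so they are
    Borel off a common null set [N]; there [g] is set to 0. *)
Lemma borel_representative (f : X -> R) :
  measurable_fun setT (f : caratheodory_type mu -> R) ->
  exists (g : borel X -> R) (N : set X), [/\ measurable_fun setT g,
    measurable (N : set (borel X)), mu N = 0 & forall x, ~ N x -> f x = g x].
Proof.
move=> mf.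
pose q (k : nat) : R := ratr (odflt 0%R (unpickle k : option rat)).
have /choice[SN HSN] : forall k, exists SN : set X * set X,
    [/\ measurable (SN.1 : set (borel X)), measurable (SN.2 : set (borel X)),
      mu SN.2 = 0 & forall x, ~ SN.2 x -> ((f x < q k)%R <-> SN.1 x)].
  move=> k.
  have cA : mu.-caratheodory [set x | (f x < q k)%R].
    have := mf measurableT _ (measurable_itv `]-oo, q k[).
    by rewrite setTI preimage_itvNyo.
  by have [S [N [mS mN N0 NS]]] := cara_borel_approx cA; exists (S, N).
pose N := \bigcup_k (SN k).2.
have mN : measurable (N : set (borel X)).
  by apply: bigcupT_measurable => n; have [] := HSN n.
pose g x : R := if `[< N x >] then 0%R else f x.
exists g, N; split => //.
- apply: (measurability _ (RGenInftyO.measurableE R)) => // _ [_ [r ->] <-].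
  rewrite setTI preimage_itvNyo.
  rewrite (_ : [set x | _] = ((\bigcup_(k in [set k | (q k < r)%R]) (SN k).1) `\` N)
      `|` (if (0 < r)%R then N else set0)).
    apply: measurableU; last by case: ifP.
    apply: measurableD => //; apply: bigcup_measurable => k _.
    by have [] := HSN k.
  apply/seteqP; split => x /=; rewrite /g.
  + case: asboolP => [Nx r0|Nx fr]; first by right; rewrite r0.
    left; split => //.
    have [t] := rat_in_itvoo fr; rewrite in_itv /= => /andP[ft tr].
    have qt : q (pickle t) = ratr t by rewrite /q pickleK.
    exists (pickle t); rewrite /= ?qt//.
    have [_ _ _ H] := HSN (pickle t).
    apply/H; last by rewrite qt.
    by move=> Nx'; apply: Nx; exists (pickle t).
  + case=> [[[k /= kr Sx] Nx]|].
      rewrite asboolF//; apply: lt_trans kr.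
      have [_ _ _ H] := HSN k; apply/H => //.
      by move=> Nx'; apply: Nx; exists k.
    by case: ifPn => // r0 Nx; rewrite asboolT.
- apply/eqP; rewrite eq_le outer_measure_ge0 andbT.
  apply: le_trans (outer_measure_sigma_subadditive _ _) _.
  by rewrite eseries0// => n _ _; have [] := HSN n.
- by move=> x Nx; rewrite /g asboolF.
Qed.

End borel_representative.

(** The completion of [eta] is the measure of its outer measure on the
    Caratheodory sigma-algebra, so [ae_borel_integral] applies to it. *)
Lemma completed_integralE (R : realType) (X : pmetricType R)
  (eta : {measure set (borel X) -> \bar R}) (N : set X) (f : X -> R) (g : borel X -> R) :
  measurable (N : set (borel X)) -> eta N = 0 -> measurable_fun setT g ->
  (forall x, ~ N x -> f x = g x) ->
  completed_integral eta f = fine (\int[eta]_x (g x)%:E).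
Proof.
move=> mN N0 mg fg; rewrite /completed_integral /Rintegral; congr fine.
pose nu0 : {outer_measure set (borel X) -> \bar R} := (eta^*)%mu.
pose nu : {outer_measure set X -> \bar R} := nu0.
have nuB (A : set X) : measurable (A : set (borel X)) -> nu.-caratheodory A.
  by move=> mA; have := @caratheodory_measurable_mu_ext _ R (borel X) eta A mA; exact.
have mnu (A : set X) : measurable (A : set (borel X)) -> eta A = nu A.
  by move=> mA; exact: esym (@measurable_mu_extE _ R (borel X) eta A mA).
have mgE : measurable_fun setT (EFin \o g) by exact/measurable_EFinP.
have fgE x : ~ N x -> (EFin \o f) x = (EFin \o g) x by move=> Nx /=; rewrite fg.
have := ae_borel_integral nuB mnu mN N0 mgE fgE.
exact.
Qed.


(** * The averages as integrals of a Borel function *)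

Lemma borel_trace (R : realType) (X : pmetricType R)
    (mu : {outer_measure set X -> \bar R}) :
  (forall A : set X, measurable (A : set (borel X)) -> mu.-caratheodory A) ->
  exists m : {measure set (borel X) -> \bar R}, forall A, m A = mu A.
Proof.
move=> muB; pose m : set (borel X) -> \bar R := mu.
have m0 : m set0 = 0 by exact: outer_measure0.
have m_ge0 A : 0 <= m A by exact: outer_measure_ge0.
have m_add : semi_sigma_additive m.
  move=> F mF tF mUF.
  apply: (@caratheodory_measure_sigma_additive _ _ mu F) => //.
  - by move=> i; exact: muB.
  - exact: muB.
pose M := isMeasure.Build _ (borel X) R m m0 m_ge0 m_add.
by exists (HB.pack_for {measure set (borel X) -> \bar R} m M).
Qed.

Section signed_integral.
Context d (T : measurableType d) (R : realType).
Variables (g : T -> R).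
Hypothesis mg : measurable_fun setT g.
Local Notation gE := (EFin \o g).
Let mgE : measurable_fun setT gE. Proof. exact/measurable_EFinP. Qed.
Let mp : measurable_fun setT gE^\+. Proof. exact: measurable_funepos. Qed.
Let mn : measurable_fun setT gE^\-. Proof. exact: measurable_funeneg. Qed.

Lemma fine_integralB (eta : {measure set T -> \bar R}) :
  eta.-integrable setT gE -> fine (\int[eta]_x gE x) =
    (fine (\int[eta]_x gE^\+ x) - fine (\int[eta]_x gE^\- x))%R.
Proof.
move=> ig; rewrite integralE fineB//.
  exact: integrable_pos_fin_num.
exact: integrable_neg_fin_num.
Qed.

Lemma fine_integral_mscale (eta : {measure set T -> \bar R}) (t : {nonneg R}) :
  eta.-integrable setT gE ->
  fine (\int[mscale t eta]_x gE x) = (t%:num * fine (\int[eta]_x gE x))%R.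
Proof.
move=> ig; rewrite [in RHS]fine_integralB// [in LHS]integralE.
have Pf : \int[eta]_x gE^\+ x \is a fin_num by exact: integrable_pos_fin_num.
have Nf : \int[eta]_x gE^\- x \is a fin_num by exact: integrable_neg_fin_num.
rewrite !ge0_integral_mscale// fineB ?fin_numM// !fineM//.
by rewrite mulrBr.
Qed.

Variable eta : {measure set T -> \bar R}^nat.
Let S := mseries eta 0.
Hypothesis ig : forall i, (eta i).-integrable setT gE.
Hypothesis igS : S.-integrable setT gE.

Let ge0_series (h : T -> \bar R) : measurable_fun setT h -> (forall x, 0 <= h x) ->
  (forall i, \int[eta i]_x h x \is a fin_num) -> \int[S]_x h x \is a fin_num ->
  series (fun i => fine (\int[eta i]_x h x)) @ \oo --> fine (\int[S]_x h x).
Proof.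
move=> mh h0 hf hS.
rewrite (_ : series _ = fine \o eseries (fun i => \int[eta i]_x h x)); last first.
  apply/funext => n /=; rewrite /series /eseries /= sum_fine//.
have H : eseries (fun i => \int[eta i]_x h x) @ \oo --> (fine (\int[S]_x h x))%:E.
  rewrite fineK// /S ge0_integral_measure_series//.
  by apply: is_cvg_nneseries => i _ _; exact: integral_ge0.
exact: (fine_cvg H).
Qed.

(** A countable sum of measures can be integrated termwise for the positive and
    the negative part separately. *)
Lemma fine_integral_mseries :
  series (fun i => fine (\int[eta i]_x gE x)) @ \oo --> fine (\int[S]_x gE x).
Proof.
rewrite fine_integralB//.
rewrite (_ : series _ = series (fun i => fine (\int[eta i]_x gE^\+ x)) \-
    series (fun i => fine (\int[eta i]_x gE^\- x)))%R; last first.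
  apply/funext => n; rewrite /series /= -sumrB.
  by apply: eq_bigr => i _; rewrite fine_integralB.
apply: cvgB; apply: ge0_series => //.
- by move=> i; exact: integrable_pos_fin_num.
- exact: integrable_pos_fin_num.
- by move=> i; exact: integrable_neg_fin_num.
- exact: integrable_neg_fin_num.
Qed.

End signed_integral.

Section main.
Context {R : realType} {X : pmetricType R}.
Local Notation bmeasure := {measure set (borel X) -> \bar R}.
Variables (mu : {outer_measure set X -> \bar R}) (p : R) (f : X -> R).
Hypothesis p1 : (1 <= p)%R.
(* [m] is the restriction of [mu] to the Borel sets, [B] a countable basis, [L] a
   cover by compact sets, and [g] a Borel function equal to [f] off [N]. *)
Variables (m : bmeasure) (B L : nat -> set X) (g : borel X -> R) (N : set X).
Hypothesis mE : forall A, m A = mu A.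
Hypothesis oB : forall k, open (B k).
Hypothesis Bb : forall x U, nbhs x U -> exists2 k, B k x & B k `<=` U.
Hypothesis cL : forall n, compact (L n).
Hypothesis LT : \bigcup_n L n = setT.
Hypothesis mball : forall (x : X) (r : R), m (ball x r) < +oo.
Hypothesis mg : measurable_fun setT g.
Hypothesis locg : forall K : set X, compact K ->
  \int[m]_(x in K) `|(g x)%:E| < +oo.
Hypotheses (mN : measurable (N : set (borel X))) (N0 : m N = 0).
Hypothesis fg : forall x, ~ N x -> f x = g x.

Lemma calM_submeasure (eta : bmeasure) : calM mu eta <-> submeasure m eta.
Proof.
by split=> -[h1 h2 h3]; split => // A mA; move: (h3 A mA); rewrite ?mE// -mE.
Qed.

Lemma calM_integrable (eta : bmeasure) : calM mu eta ->
  eta.-integrable setT (EFin \o g).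
Proof.
by move/calM_submeasure; exact: (submeasure_integrable oB Bb mg locg).
Qed.

Lemma calM_completed_integral (eta : bmeasure) : calM mu eta ->
  completed_integral eta f = fine (\int[eta]_x (g x)%:E).
Proof.
move=> [_ _ etamu]; apply: (completed_integralE mN _ mg fg).
apply/eqP; rewrite -measure_le0.
by apply: le_trans (etamu N mN) _; rewrite -mE N0.
Qed.

Lemma Fof_average (eta : bmeasure) : calM mu eta -> Fof f eta = average g eta.
Proof. by move=> etaM; rewrite /Fof calM_completed_integral. Qed.

(** The factor [mass eta] cancels unless it is 0, and then the integral is 0 too.
    Vanishing mass is a weaker condition than [eta = mzero], because the values
    of a measure on non-Borel sets are arbitrary. *)
Lemma Gof_integral (eta : bmeasure) : calM mu eta ->
  Gof (Fof f) eta = fine (\int[eta]_x (g x)%:E).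
Proof.
move=> etaM; rewrite /Gof Fof_average// /average.
have [eta0|eta0] := eqVneq (eta setT) 0.
  rewrite (null_set_integral measurableT _ eta0) ?mulr0; last exact/measurable_EFinP.
  by case: asboolP.
rewrite asboolF; last by move=> H; move: eta0; rewrite H eqxx.
rewrite mulVKf// /mass fine_eq0//.
by have [etaoo _ _] := etaM; rewrite ge0_fin_numE.
Qed.

Let P := \int[m]_x `|(g x)%:E| `^ p.

Let p0 : (0 < p)%R. Proof. exact: lt_le_trans p1. Qed.

Lemma calLnorm_le : calLnorm mu p (EFin \o Fof f) <= P `^ p^-1.
Proof.
apply: ge_ereal_sup => _ [k [eta [etaX teta ->]]].
apply: gt0_ler_poweR.
- by rewrite invr_ge0 ltW.
- rewrite in_itv /= leey andbT; apply: sume_ge0 => i _.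
  by rewrite mule_ge0// poweR_ge0.
- by rewrite in_itv /= leey andbT; apply: integral_ge0 => x _; exact: poweR_ge0.
have mgp : measurable_fun setT (fun x : borel X => `|(g x)%:E| `^ p).
  apply: (measurableT_comp (measurable_poweR p)).
  exact/measurableT_comp/measurable_EFinP.
have etam i (A : set (borel X)) : measurable A -> eta i A <= m A.
  by have [/calM_submeasure[_ _ +] _] := etaX i; exact.
apply: le_trans (sum_integral_le oB Bb etam teta mgp _); last first.
  by move=> x; exact: poweR_ge0.
apply: lee_sum => i _; have [etaM _] := etaX i.
have [->|eta0] := eqVneq (eta i setT) 0.
  by rewrite mule0 integral_ge0// => x _; exact: poweR_ge0.
rewrite /= Fof_average//; apply: power_mean_integral => //.
- by rewrite lt0e eta0 measure_ge0.
- by case: etaM.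
Qed.

Lemma calLnorm_ge0 : 0 <= calLnorm mu p (EFin \o Fof f).
Proof.
apply: (@le_trans _ _ (0 `^ p^-1)); first exact: poweR_ge0.
apply: ereal_sup_ubound; exists 0%N, (fun=> mzero); split.
- by case.
- by apply/trivIsetP => -[].
- by rewrite big_ord0.
Qed.

Lemma calLnorm_ge : P <= calLnorm mu p (EFin \o Fof f) `^ p.
Proof.
apply: (integral_powR_le oB Bb cL LT mball mg locg p1) => k eta etaM eta0 teta.
have M i : calM mu (eta i) by exact/calM_submeasure.
have s0 : 0 <= \sum_(i < k) `|(average g (eta i))%:E| `^ p * eta i setT.
  by apply: sume_ge0 => i _; rewrite mule_ge0// poweR_ge0.
rewrite -[leLHS]poweRe1// -(mulVf (lt0r_neq0 p0)) poweRrM.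
apply: gt0_ler_poweR; rewrite ?in_itv /= ?leey ?andbT ?poweR_ge0 ?(ltW p0)//.
  exact: calLnorm_ge0.
apply: ereal_sup_ubound; exists k, eta; split => //.
- move=> i; split; first exact: M.
  by move=> e; have := eta0 i; rewrite e ltxx.
- congr (_ `^ _); apply: eq_bigr => i _.
  by rewrite /= Fof_average.
Qed.

Lemma calLnormE : calLnorm mu p (EFin \o Fof f) = P `^ p^-1.
Proof.
apply/eqP; rewrite eq_le calLnorm_le /=.
have C0 := calLnorm_ge0.
rewrite -[leRHS]poweRe1// -(mulfV (lt0r_neq0 p0)) poweRrM.
apply: gt0_ler_poweR; rewrite ?in_itv /= ?leey ?andbT ?poweR_ge0 ?invr_ge0 ?(ltW p0)//.
  by apply: integral_ge0 => x _; exact: poweR_ge0.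
exact: calLnorm_ge.
Qed.

Lemma Gof_mscale (t : {nonneg R}) (eta : bmeasure) :
  (t%:num <= 1)%R -> calM mu eta ->
  Gof (Fof f) (mscale t eta) = (t%:num * Gof (Fof f) eta)%R.
Proof.
move=> t1 etaM; have [etaoo ceta etamu] := etaM.
have tM : calM mu (mscale t eta : bmeasure).
  split.
  - by rewrite /= /mscale lte_mul_pinfty// lee_fin.
  - apply: (subclosed_compact _ ceta); first exact: msupp_closed.
    move=> x xs U oU Ux; have := xs U oU Ux; rewrite /= /mscale.
    rewrite lt0e => /andP[+ _]; rewrite mule_eq0 negb_or => /andP[_ H].
    by rewrite lt0e H measure_ge0.
  - move=> A mA; apply: le_trans (etamu A mA); rewrite /= /mscale.
    by rewrite -[leRHS]mul1e lee_wpmul2r// lee_fin.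
by rewrite !Gof_integral// fine_integral_mscale//; exact: calM_integrable.
Qed.

Lemma Gof_mseries (eta : bmeasure^nat) : (forall i, calM mu (eta i)) ->
  calM mu (mseries eta 0 : bmeasure) ->
  series (fun i => Gof (Fof f) (eta i)) @ \oo --> Gof (Fof f) (mseries eta 0).
Proof.
move=> etaM SM; rewrite Gof_integral//.
rewrite (_ : (fun i => _) = fun i => fine (\int[eta i]_x (g x)%:E)); last first.
  by apply/funext => i; rewrite Gof_integral.
apply: fine_integral_mseries => //; last exact: calM_integrable.
by move=> i; exact: calM_integrable.
Qed.

End main.

(** * Equality of the norms *)

Local Close Scope ereal_scope.

(** Both parts rest on the equality of the norms, which holds without assuming
    that one of them is finite. *)
Theorem theorem5p7 (R : realType) (X : pmetricType R)
    (mu : {outer_measure set X -> \bar R}) (p : R) (f : X -> R) :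
  metric_measure_space mu -> 1 <= p -> L1loc mu f ->
  (f \in Lfun (cara_measure mu) p%:E <-> LpX mu p (Fof f)) /\
  (f \in Lfun (cara_measure mu) p%:E ->
     calLnorm mu p (EFin \o Fof f) = Lnorm (cara_measure mu) p%:E (EFin \o f)).
Proof.
move=> [lcX [D cD dD] muR muball] p1 [mf floc].
have [Bc _] := muR.
have [m mE] := borel_trace Bc.
have muballoo (x : X) (r : R) : (0 < r)%R -> (mu (ball x r) < +oo)%E.
  by move=> r0; have /andP[] := muball x r r0.
have mball (x : X) (r : R) : (m (ball x r) < +oo)%E.
  rewrite mE; have [r0|r0] := ltP 0 r; first exact: muballoo.
  rewrite (_ : ball x r = set0) ?outer_measure0//.
  rewrite -subset0 => y; rewrite ballEmdist /= => /lt_le_trans /(_ r0).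
  by rewrite ltNge mdist_ge0.
have [B [oB Bb]] := separable_countable_basis cD dD.
have [L [cL LT]] := locally_compact_sigma_compact Bb lcX.
have [g [N [mg mN N0 fg]]] := borel_representative muR muballoo mf.
have mN0 : m N = 0%E by rewrite mE.
have mEm (A : set X) : measurable (A : set (borel X)) -> m A = mu A by [].
have transfer (u : X -> \bar R) (v : borel X -> \bar R) : measurable_fun setT v ->
    (forall x, ~ N x -> u x = v x) ->
    (\int[cara_measure mu]_x u x = \int[m]_x v x)%E.
  move=> mv uv; exact: (ae_borel_integral Bc mEm mN mN0 mv uv).
have locg (K : set X) : compact K -> (\int[m]_(x in K) `|(g x)%:E| < +oo)%E.
  move=> cK; apply: le_lt_trans (floc K cK).
  have mK := compact_borel cK.
  rewrite integral_mkcond [leRHS]integral_mkcond.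
  rewrite -(transfer ((fun x => `|(f x)%:E|%E) \_ K))//.
    apply/(measurable_restrictT _ mK)/measurable_funTS.
    exact/measurableT_comp/measurable_EFinP.
  by move=> x Nx; rewrite !patchE; case: ifPn => // _; rewrite fg.
have pn0 : p != 0 by rewrite gt_eqF// (lt_le_trans _ p1).
have normE : calLnorm mu p (EFin \o Fof f) = Lnorm (cara_measure mu) p%:E (EFin \o f).
  rewrite (calLnormE p1 mE oB Bb cL LT mball mg locg mN mN0 fg).
  rewrite unlock; congr (_ `^ _)%E; apply/esym/transfer.
    apply: (measurableT_comp (measurable_poweR p)).
    exact/measurableT_comp/measurable_EFinP.
  by move=> x Nx /=; rewrite fg.
have LfunP : f \in Lfun (cara_measure mu) p%:E <->
    (Lnorm (cara_measure mu) p%:E (EFin \o f) < +oo)%E.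
  rewrite inE; split => [/andP[_]|fin]; first by rewrite inE.
  by apply/andP; split; rewrite inE.
split => //; rewrite LfunP; split => [fin|[+ _ _]]; last by rewrite /calL /= normE.
split; first by rewrite /calL /= normE.
- move=> t eta; exact: (Gof_mscale mE oB Bb mg locg mN mN0 fg).
- move=> eta; exact: (Gof_mseries mE oB Bb mg locg mN mN0 fg).
Qed.
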